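(* Let $n$ be a positive integer, $0\le n_0\le n$ an integer, $a=(a_1,\dots,a_n)$ a sequence of positive integers, $v=(v_1,\dots,v_n)\in\mathbb{Z}^n$, and $\lambda=(\lambda_1,\lambda_2,\dots)$ a partition with $|\lambda|=|v|$. For a subset $I\subseteq\{1,\dots,n\}$ let $p_I:=|\{i\in I: i\le n_0\}|$. Suppose there exists an integer $j$ with $0<j<n$ such that for every $j$-element subset $I=\{i_1,\dots,i_j\}\subseteq\{1,\dots,n\}$, \[ \sum_{k=1}^j v_{i_k}-p_I\,(n-n_0-j+p_I)<\sum_{k=1}^j\lambda_k . \] Then $D_{v,\lambda}(a;n,n_0)=0$.
   Context: For a nonnegative integer $k$, $(z)_k:=(z;q)_k=(1-z)(1-zq)\cdots(1-zq^{k-1})$. A partition is a weakly decreasing sequence of nonnegative integers with finitely many nonzero entries; $|v|$ denotes the sum of entries of a sequence $v$. The complete symmetric functions $h_r$ are defined by $\sum_{r\ge0}z^rh_r(X)=\prod_{x\in X}(1-zx)^{-1}$, and $h_\lambda:=h_{\lambda_1}h_{\lambda_2}\cdots$. Let $X^{(a;n_0)}$ be the alphabet $\{x_iq^{k}: 1\le i\le n_0,\ 0\le k\le a_i-2\}\cup\{x_iq^k: n_0+1\le i\le n,\ 0\le k\le a_i-1\}$. With $\chi(i\le n_0)$ equal to $1$ if $i\le n_0$ and $0$ otherwise, define \[ D_{v,\lambda}(a;n,n_0):=\operatorname{CT}_{x}\; x^{-v}\,h_\lambda\big(X^{(a;n_0)}\big)\prod_{1\le i<j\le n}(x_i/x_j)_{a_i-\chi(i\le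 n_0)}(qx_j/x_i)_{a_j-\chi(i\le n_0)}, \] where $x=(x_1,\dots,x_n)$, $x^{-v}=x_1^{-v_1}\cdots x_n^{-v_n}$, and $\operatorname{CT}_x$ denotes the constant term in $x_1,\dots,x_n$ (coefficients in $\mathbb{Q}(q)$). Entries $\lambda_k$ with $k>\ell(\lambda)$ are $0$. *)

(* Defs.v *)
From HB Require Import structures.
From mathcomp Require Import all_boot all_order all_algebra finmap.
From mathcomp Require Import fraction.
From mathcomp Require Import monalg.

Set Implicit Arguments.
Unset Strict Implicit.
Unset Printing Implicit Defensive.

Import GRing.Theory.
Local Open Scope fset_scope.
Local Open Scope ring_scope.

(* The Laurent polynomial ring R[x_1^{+-1}, ..., x_n^{+-1}], as the group
   algebra of Z^n: finitely supported functions from exponent vectors to R with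
   the convolution product. The module structure is the one of {malg R[_]}; its
   library ring structure is not available here because a monomType requires
   that 1 be the only invertible monomial. *)
Definition expvec (n : nat) : zmodType := {ffun 'I_n -> int}.

Definition laurent (R : comNzRingType) (n : nat) : Type := {malg R[expvec n]}.

HB.instance Definition _ (R : comNzRingType) (n : nat) :=
  GRing.Lmodule.on (laurent R n).

(* Locked, since conversion checks that unfold the product diverge. *)
HB.lock Definition lmul (R : comNzRingType) (n : nat)
    (f g : laurent R n) : laurent R n :=
  \sum_(u <- msupp f) \sum_(w <- msupp g) << f@_u * g@_w *g (u + w)%R >>.
Canonical lmul_unlockable := Unlockable lmul.unlock.

Section LaurentRing.
Context (R : comNzRingType) (n : nat).
Local Notation K := (expvec n).
Local Notation L := (laurent R n).
Local Notation lmul := (@lmul R n).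
Implicit Types (f g h : L) (u w : K) (c d : R).

Definition lmonom u : L := << u >>.

Definition lone : L := << 0 >>.

Lemma lmulw (df dg : {fset K}) f g : msupp f `<=` df -> msupp g `<=` dg ->
  lmul f g = \sum_(u <- df) \sum_(w <- dg) << f@_u * g@_w *g (u + w)%R >>.
Proof.
move=> le_df le_dg; rewrite unlock (big_fset_incl _ le_df) /=.
  apply/eq_bigr=> u _; apply/big_fset_incl => // w _ /mcoeff_outdom ->.
  by rewrite mulr0 monalgU0.
move=> u _ /mcoeff_outdom fu.
by rewrite big1 => // w _; rewrite fu mul0r monalgU0.
Qed.

Lemma lmulC : commutative lmul.
Proof.
move=> f g; rewrite unlock exchange_big; apply/eq_bigr=> w _.
by apply/eq_bigr=> u _; rewrite mulrC addrC.
Qed.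

Lemma lmulUU c d u w :
  lmul << c *g u >> << d *g w >> = << c * d *g (u + w)%R >>.
Proof. by rewrite (lmulw msuppU_le msuppU_le) !big_seq_fset1 !mcoeffUU. Qed.

Lemma lmul1l : left_id lone lmul.
Proof.
move=> f; rewrite (lmulw msuppU_le (fsubset_refl _)) big_seq_fset1.
rewrite [RHS]monalgE; apply/eq_bigr=> w _.
by rewrite mcoeffUU mul1r add0r.
Qed.

Lemma lmulDl : left_distributive lmul +%R.
Proof.
move=> f g h; rewrite (lmulw (msuppD_le f g) (fsubset_refl _)).
rewrite (lmulw (fsubsetUl (msupp f) (msupp g)) (fsubset_refl _)).
rewrite (lmulw (fsubsetUr (msupp f) (msupp g)) (fsubset_refl _)).
rewrite -big_split /=; apply/eq_bigr=> u _.
rewrite -big_split /=; apply/eq_bigr=> w _.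
by rewrite mcoeffD mulrDl monalgUD.
Qed.

Lemma lmul_suml (I : Type) (r : seq I) (F : I -> L) g :
  lmul (\sum_(i <- r) F i) g = \sum_(i <- r) lmul (F i) g.
Proof.
apply: (big_morph (lmul^~ g) (fun _ _ => lmulDl _ _ _)).
by rewrite unlock msupp0 big_seq_fset0.
Qed.

Lemma lmul_sumr (I : Type) (r : seq I) (F : I -> L) f :
  lmul f (\sum_(i <- r) F i) = \sum_(i <- r) lmul f (F i).
Proof. by rewrite lmulC lmul_suml; apply: eq_bigr => i _; rewrite lmulC. Qed.

Lemma lmulA : associative lmul.
Proof.
have El f g : lmul f g = \sum_(u <- msupp f) lmul << f@_u *g u >> g.
  by rewrite {1}[f]monalgE lmul_suml.
have Er f g : lmul f g = \sum_(w <- msupp g) lmul f << g@_w *g w >>.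
  by rewrite {1}[g]monalgE lmul_sumr.
move=> f g h; rewrite [LHS]El [lmul f g]El lmul_suml; apply: eq_bigr => u _.
rewrite [lmul g h]El lmul_sumr [lmul _ g]Er lmul_suml; apply: eq_bigr => w _.
rewrite [lmul _ h]Er lmul_sumr [RHS]Er; apply: eq_bigr => t _.
by rewrite !lmulUU mulrA addrA.
Qed.

Lemma lone_neq0 : lone != 0.
Proof. by rewrite monalgU_eq0 oner_eq0. Qed.

HB.instance Definition _ := GRing.Zmodule_isComNzRing.Build L
  lmulA lmulC lmul1l lmulDl lone_neq0.

Lemma lscaleAl c f g : c *: (f * g) = (c *: f) * g.
Proof.
have mulC h : (<< c *g 0 >> : L) * h = c *: h.
  rewrite -[LHS]/(lmul _ _) (lmulw msuppU_le (fsubset_refl _)) big_seq_fset1.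
  by rewrite malgZ_def; apply: eq_bigr => w _; rewrite mcoeffUU add0r.
by rewrite -!mulC mulrA.
Qed.

HB.instance Definition _ := GRing.Lmodule_isLalgebra.Build R L lscaleAl.
HB.instance Definition _ := GRing.Lalgebra_isComAlgebra.Build R L.

Lemma lmonom0 : lmonom 0 = 1.
Proof. by []. Qed.

Lemma lmonomD u w : lmonom (u + w) = lmonom u * lmonom w.
Proof. by rewrite -[RHS]/(lmul _ _) lmulUU mulr1. Qed.

Definition CT f : R := f@_0.

Definition evar (i : 'I_n) : K := [ffun k => (k == i)%:Z].

Definition lvar i : L := lmonom (evar i).

Definition lratio i j : L := lmonom (evar i - evar j).

Lemma lratioP i j : lratio i j * lvar j = lvar i.
Proof. by rewrite -lmonomD subrK. Qed.

End LaurentRing.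

Arguments lvar {R n} i.
Arguments lratio {R n} i j.

Definition qpoch (R : comNzRingType) (A : comAlgType R) (q : R) (z : A)
    (k : nat) : A :=
  \prod_(i < k) (1 - q ^+ i *: z).

Section CompleteSymmetric.
Context (R : comNzRingType).

(* The coefficient of z^r in \prod_(x in X) (1 - z x)^-1, where (1 - z x)^-1 is
   the geometric series of z x: truncating each factor after degree r does not
   change that coefficient. *)
Definition hsym (X : seq R) (r : nat) : R :=
  (\prod_(x <- X) \poly_(k < r.+1) x ^+ k)`_r.

Definition hsym_part (X : seq R) (lam : seq nat) : R :=
  \prod_(r <- lam) hsym X r.

Let ptr N (p p' : {poly R}) := forall r, (r < N)%N -> p`_r = p'`_r.

Let ptrM N p1 p1' p2 p2' :
  ptr N p1 p1' -> ptr N p2 p2' -> ptr N (p1 * p2) (p1' * p2').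
Proof.
move=> e1 e2 r rN; rewrite !coefM; apply: eq_bigr => i _.
rewrite e1 ?e2 //.
  by apply: leq_ltn_trans rN; rewrite leq_subr.
by apply: leq_ltn_trans rN; rewrite -ltnS.
Qed.

(* The generating function identity, which determines hsym. *)
Lemma hsym_genfun (X : seq R) (r : nat) :
  \sum_(k < r.+1) (\prod_(x <- X) (1 - x *: 'X))`_k * hsym X (r - k)
  = (r == 0%N)%:R.
Proof.
pose G N := \prod_(x <- X) \poly_(k < N) x ^+ k.
have Gtr N : ptr N (\prod_(x <- X) (1 - x *: 'X) * G N) 1.
  rewrite /G -big_split /=.
  elim: (X) => [|x Y IH]; first by rewrite big_nil.
  rewrite big_cons -[X in ptr _ _ X]mulr1; apply: ptrM => // k kN.
  rewrite mulrBl mul1r -scalerAl coefB coefZ coefXM !coef_poly kN coef1.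
  case: k kN => [|k] kN /=; first by rewrite mulr0 subr0 expr0.
  by rewrite (ltnW kN) exprS subrr.
have GE N k : (k < N)%N -> hsym X k = (G N)`_k.
  move=> kN; rewrite /hsym /G.
  suff /(_ k (ltnSn k)): ptr k.+1 (\prod_(x <- X) \poly_(i < k.+1) x ^+ i)
                 (\prod_(x <- X) \poly_(i < N) x ^+ i) by [].
  elim: (X) => [|x Y IH]; first by rewrite !big_nil.
  rewrite !big_cons; apply: ptrM => // j jk.
  by rewrite !coef_poly jk (leq_trans jk kN).
rewrite -[RHS]coef1 -(Gtr r.+1) // coefM; apply: eq_bigr => k _.
by rewrite (GE r.+1) // ltnS leq_subr.
Qed.

End CompleteSymmetric.

Definition is_partition (lam : seq nat) : bool := sorted geq lam.

Definition Qq : fieldType := {fraction {poly rat}}.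
Definition qvar : Qq := @FracField.tofrac {poly rat} 'X.

Section ConstantTerm.
Context (n n0 : nat) (a : 'I_n -> nat).
Local Notation L := (laurent Qq n).

(* Indices are 0-based: i : 'I_n stands for the index i + 1 of {1, ..., n}, so
   that (i < n0)%N is the condition "index <= n_0". *)
Definition chi (i : 'I_n) : nat := (i < n0)%N.

Definition alphabet : seq L :=
  [seq qvar ^+ k *: lvar i | i <- enum 'I_n, k <- iota 0 (a i - chi i)].

Definition qDyson : L :=
  \prod_(i < n) \prod_(j < n | (i < j)%N)
    (qpoch qvar (lratio i j) (a i - chi i) *
     qpoch qvar (qvar *: lratio j i) (a j - chi i)).

Definition Dct (v : expvec n) (lam : seq nat) : Qq :=
  CT (lmonom Qq (- v) * hsym_part alphabet lam * qDyson).

End ConstantTerm.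

(* Main.v *)
(* The support of h_mu(X) times the q-Dyson product is located directly. By
   Lagrange interpolation in the letters of the alphabet, h_r(X) times the
   product is a sum, over the variables x_i, of x_i^r times a Laurent polynomial
   times the q-Dyson product in the remaining variables: for a letter y = x_i q^k
   the denominators y - x_l q^m divide the pair factor of i and l, and the
   quotient only involves powers (x_i/x_l)^e with e >= 0, and even e >= 1 when
   i <= n_0 < l. Peeling off mu_1, ..., mu_j in this way, every monomial of the
   result has, for some set K of j variables, degree in the variables of K at
   least mu_1 + ... + mu_j + p_K (n - n_0 - j + p_K). The remaining h's have
   nonnegative exponents, so after multiplication by x^-v this degree is positive
   and there is no constant term. *)
Require Import Defs.
From mathcomp Require Import all_boot all_order all_algebra.
From mathcomp Require Import finmap fraction monalg.
From mathcomp Require Import zify ring.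

Set Implicit Arguments.
Unset Strict Implicit.
Unset Printing Implicit Defensive.

Import Order.TTheory GRing.Theory Num.Theory.
Local Open Scope ring_scope.

Section Hsym.
Context (R : comNzRingType).
Implicit Types (X Y : seq R) (x : R).

Lemma hsym_trunc X r N : (r < N)%N ->
  hsym X r = (\prod_(x <- X) \poly_(k < N) x ^+ k)`_r.
Proof.
have trM (p1 p2 p3 p4 : {poly R}) M :
    (forall k, (k < M)%N -> p1`_k = p2`_k) -> (forall k, (k < M)%N -> p3`_k = p4`_k) ->
    forall k, (k < M)%N -> (p1 * p3)`_k = (p2 * p4)`_k.
  move=> e1 e2 k kM; rewrite !coefM; apply: eq_bigr => i _.
  by rewrite e1 ?e2 //; have := ltn_ord i; lia.
move=> rN; rewrite /hsym.
suff H k : (k < r.+1)%N -> (\prod_(x <- X) \poly_(i < r.+1) x ^+ i)`_k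
                 = (\prod_(x <- X) \poly_(i < N) x ^+ i)`_k by apply: H.
elim: X k => [|x X IH] k; first by rewrite !big_nil.
rewrite !big_cons; apply: trM => // j jr.
by rewrite !coef_poly jr (leq_trans jr rN).
Qed.

Lemma hsym_nil r : hsym ([::] : seq R) r = (r == 0%N)%:R.
Proof. by rewrite /hsym big_nil coef1. Qed.

Lemma hsym0 X : hsym X 0 = 1.
Proof.
elim: X => [|x X IH]; first by rewrite hsym_nil.
rewrite /hsym big_cons coef0M -/(hsym X 0) IH coef_poly expr0 mulr1 //.
Qed.

Lemma hsym_cat X Y r :
  hsym (X ++ Y) r = \sum_(m < r.+1) hsym X m * hsym Y (r - m).
Proof.
rewrite /hsym big_cat coefM; apply: eq_bigr => m _.
by rewrite -!hsym_trunc //; have := ltn_ord m; lia.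
Qed.

Lemma hsym1 x r : hsym [:: x] r = x ^+ r.
Proof. by rewrite /hsym big_seq1 coef_poly ltnSn. Qed.

Lemma hsym_cons x X r :
  hsym (x :: X) r = \sum_(m < r.+1) x ^+ m * hsym X (r - m).
Proof.
by rewrite -cat1s hsym_cat; apply: eq_bigr => m _; rewrite hsym1.
Qed.

Lemma hsym_consS x X r :
  hsym (x :: X) r.+1 = hsym X r.+1 + x * hsym (x :: X) r.
Proof.
rewrite !hsym_cons big_ord_recl expr0 mul1r subn0; congr +%R.
by rewrite mulr_sumr; apply: eq_bigr => m _; rewrite exprS mulrA.
Qed.

Lemma hsym_perm X Y r : perm_eq X Y -> hsym X r = hsym Y r.
Proof. by move=> e; rewrite /hsym (perm_big _ e). Qed.

Lemma hsym_divdiff x y X r :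
  (x - y) * hsym (x :: y :: X) r = hsym (x :: X) r.+1 - hsym (y :: X) r.+1.
Proof.
have e1 := hsym_consS x (y :: X) r.
have := hsym_consS y (x :: X) r.
rewrite !(@hsym_perm (y :: x :: X) (x :: y :: X)); last first.
- by rewrite (perm_catCA [:: y] [:: x] X).
- by rewrite (perm_catCA [:: y] [:: x] X).
by rewrite e1 => /eqP; rewrite addrC -subr_eq => /eqP e2; rewrite -e2; ring.
Qed.

(* Lagrange interpolation: A y is D / \prod_(x != y) (y - x), and regularity of
   the differences replaces working in a field of fractions. *)
Lemma hsym_lagrange (T : eqType) (f : T -> R) (s : seq T) (D : R)
    (A : T -> R) r :
  s != [::] -> uniq s ->
  {in s &, forall u v : T, u != v -> GRing.lreg (f u - f v)} ->
  {in s, forall v : T, \prod_(u <- s | u != v) (f v - f u) * A v = D} ->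
  hsym (map f s) r * D = \sum_(y <- s) f y ^+ (r + (size s).-1) * A y.
Proof.
have [N] := ubnP (size s); elim: N s A r => // N IH [//|x [|y s]] A r sN _ us reg hA.
  rewrite hsym1 big_seq1 addn0; congr (_ * _).
  by rewrite -(hA x) ?mem_head // big_cons big_nil eqxx mul1r.
have /andP[xys us'] : (x \notin y :: s) && uniq (y :: s) by [].
have /andP[ys us0] := us'.
have nxy : x != y by move: xys; rewrite inE negb_or => /andP[].
have xs : x \notin s by move: xys; rewrite inE negb_or => /andP[].
have rxy : GRing.lreg (f x - f y) by apply: reg; rewrite ?inE ?eqxx ?orbT.
have subx u : u \in x :: s -> u \in x :: y :: s.
  by rewrite !inE => /orP[]->; rewrite ?orbT.
have IHx : hsym (map f (x :: s)) r.+1 * D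
    = \sum_(z <- x :: s) f z ^+ (r + (size s).+1) * ((f z - f y) * A z).
  rewrite (IH (x :: s) (fun z => (f z - f y) * A z)) ?addSnnS //; last 3 first.
  - by rewrite /= xs.
  - by move=> u v /subx hu /subx hv; apply: reg.
  move=> z hz; rewrite -(hA z); last exact: subx.
  rewrite mulrA; congr (_ * _); rewrite !big_cons.
  have -> : y != z by apply: contraTneq hz => <-; rewrite inE negb_or eq_sym nxy.
  by case: ifP => _; ring.
have IHy : hsym (map f (y :: s)) r.+1 * D
    = \sum_(z <- y :: s) f z ^+ (r + (size s).+1) * ((f z - f x) * A z).
  rewrite (IH (y :: s) (fun z => (f z - f x) * A z)) ?addSnnS //; last 2 first.
  - by move=> u v hu hv; apply: reg; rewrite inE ?hu ?hv orbT.
  move=> z hz; rewrite -(hA z); last by rewrite inE hz orbT.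
  rewrite mulrA; congr (_ * _); rewrite !big_cons.
  have -> : x != z by apply: contraTneq hz => <-.
  by case: ifP => _; ring.
apply: rxy => /=; rewrite mulrA hsym_divdiff mulrBl IHx IHy !big_cons.
rewrite !mulrDr mulr_sumr.
rewrite (_ : \sum_(z <- s) (f x - f y) * _ =
  \sum_(z <- s) f z ^+ (r + (size s).+1) * ((f z - f y) * A z)
  - \sum_(z <- s) f z ^+ (r + (size s).+1) * ((f z - f x) * A z)); first by ring.
by rewrite -sumrB; apply: eq_bigr => z _; ring.
Qed.

Lemma hsym_part_split X (lam : seq nat) j :
  hsym_part X lam
  = (\prod_(k < j) hsym X (nth 0%N lam k)) * hsym_part X (drop j lam).
Proof.
rewrite /hsym_part; elim: j lam => [|j IH] lam; first by rewrite big_ord0 mul1r drop0.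
case: lam => [|r lam]; last by rewrite big_cons (IH lam) big_ord_recl mulrA.
by rewrite big_nil mulr1 big1 // => k _; rewrite nth_nil hsym0.
Qed.

End Hsym.

Section LaurentSupport.
Context (F : fieldType) (n : nat).
Local Notation L := (laurent F n).
Local Notation E := (expvec n).
Implicit Types (f g : L) (u w : E) (K : {set 'I_n}) (d e : int).

Lemma mcoeff_lmonomM u w f : (lmonom F u * f)@_(u + w) = f@_w.
Proof.
rewrite -[_ * f]/(@lmul _ _ _ _) (lmulw msuppU_le (fsubset_refl _)) big_seq_fset1.
rewrite mcoeffUU [in LHS]raddf_sum /=.
rewrite [in RHS](monalgE f) raddf_sum /=; apply: eq_bigr => k _.
by rewrite !mcoeffU mul1r (inj_eq (addrI u)).
Qed.

Lemma msuppM f g u : u \in msupp (f * g) ->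
  exists u1 u2, [/\ u1 \in msupp f, u2 \in msupp g & u = u1 + u2].
Proof.
rewrite -mcoeff_neq0 -[f * g]/(@lmul _ _ f g) unlock raddf_sum /= => nz.
have [u1 h1 {}nz] : exists2 u1, u1 \in msupp f &
    (\sum_(w <- msupp g) << f@_u1 * g@_w *g (u1 + w)%R >>)@_u != 0.
  apply/hasP/(contraNT _ nz) => /hasPn h; rewrite big_seq big1 // => k /h.
  by rewrite negbK => /eqP.
rewrite raddf_sum /= in nz.
have [u2 h2 {}nz] : exists2 u2, u2 \in msupp g &
    (<< f@_u1 * g@_u2 *g (u1 + u2)%R >>)@_u != 0.
  apply/hasP/(contraNT _ nz) => /hasPn h; rewrite big_seq big1 // => k /h.
  by rewrite negbK => /eqP.
exists u1, u2; split=> //; apply/eqP; apply: contraNT nz.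
by rewrite mcoeffU eq_sym => /negPf->; rewrite mulr0n.
Qed.

Definition supp_in (P : E -> Prop) f := forall u, u \in msupp f -> P u.

Lemma supp_in_sum P (I : Type) (r : seq I) (A : pred I) (G : I -> L) :
  (forall i, A i -> supp_in P (G i)) -> supp_in P (\sum_(i <- r | A i) G i).
Proof.
move=> h; elim/big_ind: _ => [u||]; [by rewrite msupp0|move=> f g hf hg u|exact: h].
by move/(fsubsetP (msuppD_le f g)); rewrite in_fsetU => /orP[/hf|/hg].
Qed.

Lemma supp_in_scale P c f : supp_in P f -> supp_in P (c *: f).
Proof. by move=> h u /(fsubsetP (msuppZ_le c f))/h. Qed.

Definition wdeg K u : int := \sum_(i in K) u i.

Lemma wdeg0 K : wdeg K 0 = 0.
Proof. by rewrite /wdeg big1 // => i _; rewrite ffunE. Qed.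

Lemma wdegD K u w : wdeg K (u + w) = wdeg K u + wdeg K w.
Proof. by rewrite -big_split; apply: eq_bigr => i _; rewrite ffunE. Qed.

Lemma wdegN K u : wdeg K (- u) = - wdeg K u.
Proof. by rewrite -sumrN; apply: eq_bigr => i _; rewrite ffunE. Qed.

Lemma wdegMn K u r : wdeg K (u *+ r) = wdeg K u *+ r.
Proof. by rewrite -sumrMnl; apply: eq_bigr => i _; rewrite ffunMnE. Qed.

Lemma wdeg_evar K i : wdeg K (evar i) = (i \in K)%:Z.
Proof.
rewrite /wdeg; case: (boolP (i \in K)) => iK.
  rewrite (bigD1 i) //= ffunE eqxx big1 ?addr0 // => k /andP[_ /negPf ki].
  by rewrite ffunE ki.
by rewrite big1 // => k kK; rewrite ffunE; case: eqP => // ki; rewrite -ki kK in iK.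
Qed.

Definition ge_deg K d : L -> Prop := supp_in (fun u => d <= wdeg K u).

Lemma ge_degW K d e f : e <= d -> ge_deg K d f -> ge_deg K e f.
Proof. by move=> ed h u /h; apply: le_trans. Qed.

Lemma ge_degM K d e f g : ge_deg K d f -> ge_deg K e g -> ge_deg K (d + e) (f * g).
Proof.
by move=> hf hg u /msuppM[u1 [u2 [/hf h1 /hg h2 ->]]]; rewrite wdegD lerD.
Qed.

Lemma ge_deg_mon K u : ge_deg K (wdeg K u) (lmonom F u).
Proof. by move=> w; move/(fsubsetP msuppU_le); rewrite inE => /eqP->. Qed.

Lemma ge_deg1 K : ge_deg K 0 1.
Proof.
by rewrite -lmonom0 -(wdeg0 K); apply: ge_deg_mon.
Qed.

Lemma ge_deg_prod K (I : Type) (r : seq I) (A : pred I) (d : I -> int) (G : I -> L) :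
  (forall i, A i -> ge_deg K (d i) (G i)) ->
  ge_deg K (\sum_(i <- r | A i) d i) (\prod_(i <- r | A i) G i).
Proof.
move=> h; elim/big_rec2: _ => [|i f e Ai IH]; first exact: ge_deg1.
by apply: ge_degM => //; apply: h.
Qed.

Lemma ge_deg_prod0 K (I : Type) (r : seq I) (A : pred I) (G : I -> L) :
  (forall i, A i -> ge_deg K 0 (G i)) -> ge_deg K 0 (\prod_(i <- r | A i) G i).
Proof. by move/ge_deg_prod => /(_ r); rewrite big1. Qed.

Lemma ge_degX K d f k : ge_deg K d f -> ge_deg K (d *+ k) (f ^+ k).
Proof.
move=> h; elim: k => [|k IH]; first exact: ge_deg1.
by rewrite exprS mulrS; apply: ge_degM.
Qed.

Lemma ge_deg_lin K d c u : d <= 0 -> d <= wdeg K u ->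
  ge_deg K d (1 - c *: lmonom F u).
Proof.
move=> d0 du w; move/(fsubsetP (msuppB_le _ _)); rewrite in_fsetU => /orP[].
  by move/(@ge_deg1 K); apply: le_trans.
move/(@supp_in_scale (fun u => d <= wdeg K u)); apply => v /(@ge_deg_mon K).
exact: le_trans.
Qed.

Lemma lmonomK u : lmonom F (- u) * lmonom F u = 1.
Proof. by rewrite -lmonomD addNr. Qed.

Lemma lmonom_lreg u : GRing.lreg (lmonom F u).
Proof. by move=> f g /(congr1 ( *%R (lmonom F (- u)))); rewrite !mulrA lmonomK !mul1r. Qed.

Lemma scale_lreg c f : c != 0 -> GRing.lreg f -> GRing.lreg (c *: f).
Proof.
move=> c0 h g1 g2 /=; rewrite -!scalerAl => /(congr1 (GRing.scale c^-1)).
by rewrite !scalerA mulVf // !scale1r => /h.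
Qed.

(* If f = c x^w f with w_l > 0 and c <> 0, then the support of f is stable under
   adding w, hence empty since it is finite. *)
Lemma binom_lreg c w (l : 'I_n) : c != 0 -> 0 < w l -> GRing.lreg (1 - c *: lmonom F w : L).
Proof.
move=> c0 wl; apply: mulrI0_lreg => f /eqP.
rewrite mulrBl mul1r -scalerAl subr_eq0 => /eqP ef.
have shift u : u \in msupp f -> w + u \in msupp f.
  rewrite -!mcoeff_neq0 {2}ef mcoeffZ mcoeff_lmonomM => fu.
  by rewrite mulf_neq0.
have iter_shift u m : u \in msupp f -> w *+ m + u \in msupp f.
  by move=> hu; elim: m => [|m IH]; rewrite ?add0r // mulrS -addrA shift.
apply/malgP => u; rewrite mcoeff0; apply: mcoeff_outdom; apply/negP => hu.
pose M : int := (\sum_(v <- msupp f) `|v l|)%R.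
have bnd v : v \in msupp f -> v l <= M.
  move=> hv; apply: le_trans (ler_norm _) _; rewrite /M (big_rem v) //=.
  by rewrite lerDl sumr_ge0.
have := bnd _ (iter_shift u (`|M|.+1 + `|u l|)%N hu).
rewrite ffunE ffunMnE -mulr_natr natz => le_M.
have le_k : (`|M|.+1 + `|u l|)%N%:Z <= w l * (`|M|.+1 + `|u l|)%N by rewrite ler_peMl.
by move: (w l * _) le_k le_M => /= p; move: (u l) (M) => b m; lia.
Qed.

End LaurentSupport.

Section QuotientAlgebra.
Context (F : fieldType) (q : F) (q_inj : injective (fun k => q ^+ k)).
Context (A : comAlgType F).
Implicit Types (x y t : A) (al B C b k : nat).

Lemma qX_neq0 k : q ^+ k != 0.
Proof.
rewrite expf_neq0 //; apply/eqP => q0.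
by have /q_inj : q ^+ 1 = q ^+ 2 by rewrite q0 !expr0n.
Qed.

Definition qprod t (m k : nat) : A := \prod_(m <= s < k) (1 - q ^+ s *: t).

Lemma qprod_cat t m k p : (m <= k)%N -> (k <= p)%N ->
  qprod t m p = qprod t m k * qprod t k p.
Proof. by move=> mk kp; rewrite /qprod -big_cat_nat. Qed.

(* A letter q^m y with m <= k contributes, up to the unit - q^m y, the factor
   1 - q^(k-m) t with t = x/y; a letter with m >= k contributes, up to q^k x, the
   factor 1 - q^(m-k) u with u = y/x. *)
Lemma letters_prod_below x y t k p : y * t = x -> (p <= k.+1)%N ->
  exists2 c : F, c != 0 &
  \prod_(0 <= m < p) (q ^+ k *: x - q ^+ m *: y) = c *: (y ^+ p * qprod t (k.+1 - p) k.+1).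
Proof.
move=> tP; elim: p => [|p IH] pk.
  by exists 1; rewrite ?oner_neq0 // /qprod subn0 !big_geq // mulr1 scale1r.
have [c c0 cE] := IH (ltnW pk); exists (c * - q ^+ p).
  by rewrite mulf_neq0 ?oppr_eq0 ?qX_neq0.
rewrite big_nat_recr //= cE [in RHS](@qprod_cat _ _ (k.+1 - p)); [|by lia..].
rewrite (_ : (k.+1 - p = (k.+1 - p.+1).+1)%N); last by lia.
rewrite [qprod t (k.+1 - p.+1) _]/qprod big_nat1.
rewrite (_ : q ^+ k *: x - q ^+ p *: y = - q ^+ p *: (y * (1 - q ^+ (k.+1 - p.+1) *: t))).
  by rewrite -!scalerAl -!scalerAr -!scalerA exprSr; congr (_ *: _); congr (_ *: _); ring.
rewrite mulrBr mulr1 -scalerAr tP scalerBr !scaleNr scalerA opprK -exprD [in RHS]addrC.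
by congr (q ^+ _ *: _ - _); lia.
Qed.

Lemma letters_prod_above x y t k m0 r p : x * t = y -> (m0 = r + k)%N \/ p = 0%N ->
  exists2 c : F, c != 0 &
  \prod_(m0 <= m < m0 + p) (q ^+ k *: x - q ^+ m *: y) = c *: (x ^+ p * qprod t r (r + p)).
Proof.
move=> tP; elim: p => [|p IH] hp.
  by exists 1; rewrite ?oner_neq0 // /qprod !addn0 !big_geq // mulr1 scale1r.
have {}hp : (m0 = r + k)%N by case: hp.
have [c c0 cE] := IH (or_introl hp); exists (c * q ^+ k).
  by rewrite mulf_neq0 ?qX_neq0.
rewrite !addnS big_nat_recr ?leq_addr //= cE /qprod big_nat_recr ?leq_addr //=.
rewrite (_ : q ^+ k *: x - q ^+ (m0 + p) *: y = q ^+ k *: (x * (1 - q ^+ (r + p) *: t))).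
  by rewrite -!scalerAl -!scalerAr -!scalerA exprSr; congr (_ *: _); congr (_ *: _); ring.
rewrite mulrBr mulr1 -scalerAr tP scalerBr scalerA -exprD.
by congr (_ - q ^+ _ *: _); lia.
Qed.

(* For the q-Dyson pair of i (with letter q^k x) and l, al = 0 is the case i < l
   and al = 1 the case l < i; the factor m = k comes from the product in t in the
   first case and from the product in u in the second one. *)
Lemma letters_quotient x y t u al B C b k :
  y * t = x -> x * u = y ->
  (al <= 1)%N -> (k < al + B)%N -> (b + al <= C.+1)%N ->
  exists n1 n2 c, [/\ (n1 + n2 = b)%N, (n2 <= C)%N &
    \prod_(0 <= m < b) (q ^+ k *: x - q ^+ m *: y)
    * (c *: (t ^+ n1 * (qprod t al (k.+1 - n1) * qprod t k.+1 (al + B))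
             * qprod u (1 - al + n2) (1 - al + C)))
    = x ^+ b * (qprod t al (al + B) * qprod u (1 - al) (1 - al + C))].
Proof.
move=> tP uP al1 kB bC; pose n1 := minn (k.+1 - al) b; pose n2 := (b - n1)%N.
have bE : (n1 + n2 = b)%N by rewrite /n2 /n1; lia.
have [|c1 c1_0 E1] := @letters_prod_below x y t k n1 tP; first by rewrite /n1; lia.
have [|c2 c2_0 E2] := @letters_prod_above x y u k n1 (1 - al) n2 uP.
  by rewrite /n2 /n1; lia.
exists n1, n2, (c1 * c2)^-1; split; [by []|by rewrite /n2 /n1; lia|].
rewrite (@big_cat_nat _ _ _ n1) //=; last by lia.
rewrite E1 -bE E2 (@qprod_cat t al (k.+1 - n1) (al + B)); [|by rewrite /n1; lia..].
rewrite (@qprod_cat t (k.+1 - n1) k.+1 (al + B)); [|by lia..].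
rewrite (@qprod_cat u (1 - al) (1 - al + n2) (1 - al + C)); [|by rewrite /n2 /n1; lia..].
rewrite -!scalerAl -!scalerAr -!scalerAl !scalerA.
rewrite mulrAC mulfV ?mulf_neq0 // scale1r exprD.
by rewrite (_ : x ^+ n1 = y ^+ n1 * t ^+ n1); [ring|rewrite -exprMn tP].
Qed.

End QuotientAlgebra.

Section Quotient.
Context (F : fieldType) (q : F) (q_inj : injective (fun k => q ^+ k)) (n : nat).
Local Notation L := (laurent F n).
Implicit Types (i l : 'I_n) (k m b : nat) (K : {set 'I_n}).

Definition letter (z : 'I_n * nat) : L := q ^+ z.2 *: lvar z.1.

Lemma letter_lreg (y z : 'I_n * nat) : y != z -> GRing.lreg (letter y - letter z).
Proof.
case: y z => i k [l m] /=; rewrite /letter /=.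
have [->|il] := eqVneq i l.
  move=> km; rewrite -scalerBl; apply: scale_lreg; last exact: lmonom_lreg.
  by rewrite subr_eq0; apply: contraNneq km => /q_inj ->.
move=> _.
have -> : q ^+ k *: lvar i - q ^+ m *: lvar l
   = (q ^+ k *: lvar i) * (1 - (q ^+ m / q ^+ k) *: lratio l i) :> L.
  rewrite mulrBr mulr1 -scalerAl -scalerAr scalerA [lvar i * _]mulrC lratioP.
  by rewrite mulrC divfK // qX_neq0.
apply: lregM; first by apply: scale_lreg (qX_neq0 q_inj k) _; apply: lmonom_lreg.
apply: (@binom_lreg _ _ _ _ l); first by rewrite mulf_neq0 ?invr_eq0 ?qX_neq0.
by rewrite !ffunE eqxx eq_sym (negPf il).
Qed.

Lemma wdeg_ratio K i l : i \in K ->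
  wdeg K (evar i - evar l) = (l \notin K)%:Z.
Proof. by move=> iK; rewrite wdegD wdegN !wdeg_evar iK; case: (l \in K). Qed.

Lemma ge_deg_qprod_ratio K i l m p : i \in K ->
  ge_deg K 0 (qprod q (lratio i l : L) m p).
Proof.
move=> iK; apply: ge_deg_prod0 => s _; apply: ge_deg_lin => //.
by rewrite wdeg_ratio.
Qed.

Lemma ge_deg_qprod_ratio_inv K i l m p : i \in K ->
  ge_deg K (- ((l \notin K)%:Z * (p - m)%N%:Z)) (qprod q (lratio l i : L) m p).
Proof.
move=> iK; set d := (l \notin K)%:Z.
have /(_ (index_iota m p) xpredT) := @ge_deg_prod F n K nat _ _ (fun=> - d)
   (fun s => 1 - q ^+ s *: lratio l i).
rewrite sumr_const_nat -mulr_natr natz mulNr; apply => s _.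
apply: ge_deg_lin; first by rewrite oppr_le0.
by rewrite -opprB wdegN wdeg_ratio.
Qed.

Lemma letters_quotient_deg i l (al B C b k : nat) :
  (al <= 1)%N -> (k < al + B)%N -> (b + al <= C.+1)%N ->
  exists Q : L,
    \prod_(0 <= m < b) (letter (i, k) - letter (l, m)) * Q
      = lvar i ^+ b * (qprod q (lratio i l) al (al + B)
                       * qprod q (lratio l i) (1 - al) (1 - al + C))
    /\ forall K, i \in K -> ge_deg K ((l \notin K)%:Z * (b%:Z - C%:Z)) Q.
Proof.
move=> al1 kB bC.
have [||n1 [n2 [c [bE n2C QE]]]] := @letters_quotient F q q_inj L (lvar i) (lvar l)
  (lratio i l) (lratio l i) al B C b k _ _ al1 kB bC.
- by rewrite mulrC lratioP.
- by rewrite mulrC lratioP.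
eexists; split; first exact: QE.
move=> K iK; apply: supp_in_scale.
have ht : ge_deg K ((l \notin K)%:Z *+ n1) (lratio i l ^+ n1 : L).
  by apply: ge_degX; rewrite -(wdeg_ratio l iK); apply: ge_deg_mon.
have hU := ge_degM (@ge_deg_qprod_ratio K i l al (k.+1 - n1) iK)
  (@ge_deg_qprod_ratio K i l k.+1 (al + B) iK).
have hV := @ge_deg_qprod_ratio_inv K i l (1 - al + n2) (1 - al + C) iK.
apply: (ge_degW _ (ge_degM (ge_degM ht hU) hV)).
rewrite !addr0 -mulr_natr natz -mulrBr; apply: ler_wpM2l => //.
by lia.
Qed.
End Quotient.

Lemma seq_choice (T : eqType) (U : Type) (u0 : U) (P : T -> U -> Prop) (s : seq T) :
  (forall x, x \in s -> exists y, P x y) -> exists f, forall x, x \in s -> P x (f x).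
Proof.
elim: s => [|x s IH] h; first by exists (fun=> u0).
have [f hf] : exists f, forall y, y \in s -> P y (f y).
  by apply: IH => y ys; apply: h; rewrite inE ys orbT.
have [v hv] := h x (mem_head x s).
exists (fun y => if y == x then v else f y) => y; rewrite inE.
by case: eqVneq => [->|_] //= /hf.
Qed.

Lemma residue_cancel (F : fieldType) (A : comAlgType F) (c : F)
    (X1 X2 P Q U D w : A) :
  c != 0 -> P * Q = X2 * U -> X1 * X2 * w = 1 ->
  c *: X1 * P * (w * (c^-1 *: Q * D)) = U * D.
Proof.
move=> c0 e1 e2; rewrite -!scalerAl -!scalerAr !scalerA mulfV // scale1r.
transitivity (X1 * w * (P * Q) * D); first by ring.
by rewrite e1; transitivity (X1 * X2 * w * U * D); [ring|rewrite e2 mul1r].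
Qed.

Lemma prod_ordered_pairs_setD1 (R : comNzRingType) n (d : 'I_n -> 'I_n -> R)
    (S : {set 'I_n}) i : i \in S ->
  \prod_(i in S) \prod_(j in S | (i < j)%N) d i j
  = \prod_(l in S :\ i) (if (i < l)%N then d i l else d l i)
    * \prod_(h in S :\ i) \prod_(j in S :\ i | (h < j)%N) d h j.
Proof.
move=> iS; rewrite (big_setD1 i iS) /=.
have e1 : \prod_(j in S | (i < j)%N) d i j
    = \prod_(l in S :\ i) (if (i < l)%N then d i l else 1).
  rewrite -big_mkcondr; apply: eq_bigl => l; rewrite !inE.
  by case: eqVneq => // ->; rewrite ltnn andbF.
have e2 l : l \in S :\ i -> \prod_(j in S | (l < j)%N) d l j
    = (if (l < i)%N then d l i else 1) * \prod_(j in S :\ i | (l < j)%N) d l j.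
  move=> lS; case: ifP => li.
    rewrite (bigD1 i) ?iS //=; congr (_ * _); apply: eq_bigl => j; rewrite !inE.
    by rewrite andbC andbA.
  rewrite mul1r; apply: eq_bigl => j; rewrite !inE.
  by case: eqVneq => // ->; rewrite li andbF.
rewrite (eq_bigr _ e2) big_split mulrA; congr (_ * _).
rewrite e1 -big_split; apply: eq_bigr => l; rewrite !inE => /andP[li _] /=.
case: (ltngtP i l) => [_|_|e]; rewrite ?mulr1 ?mul1r //.
by case/eqP: li; apply: val_inj.
Qed.

Section Dyson.
Context (F : fieldType) (q : F) (q_inj : injective (fun k => q ^+ k)).
Context (n n0 : nat) (a : 'I_n -> nat) (a_gt0 : forall i, (0 < a i)%N).
Local Notation L := (laurent F n).
Implicit Types (i l : 'I_n) (k m : nat) (J K S : {set 'I_n}).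

Local Notation b i := (a i - chi n0 i)%N.
Local Notation letter := (@letter F q n).

Definition dpair i j : L :=
  qpoch q (lratio i j) (a i - chi n0 i) * qpoch q (q *: lratio j i) (a j - chi n0 i).

Definition upair i l : L := if (i < l)%N then dpair i l else dpair l i.

Definition dyson S : L := \prod_(i in S) \prod_(j in S | (i < j)%N) dpair i j.

Lemma dyson_setD1 S i : i \in S ->
  dyson S = \prod_(l in S :\ i) upair i l * dyson (S :\ i).
Proof. exact: prod_ordered_pairs_setD1. Qed.

Lemma qpoch_qprod (x : L) k : qpoch q x k = qprod q x 0 k.
Proof. by rewrite /qpoch /qprod big_mkord. Qed.

Lemma qpoch_shift (x : L) k : qpoch q (q *: x) k = qprod q x 1 k.+1.
Proof.
rewrite /qpoch /qprod big_add1 /= big_mkord; apply: eq_bigr => s _.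
by rewrite scalerA exprSr.
Qed.

Lemma chi_le1 i : (chi n0 i <= 1)%N.
Proof. by rewrite /chi; case: (_ < _)%N. Qed.

Lemma upair_quotient i l k : i != l -> (k < b i)%N -> exists Q : L,
  \prod_(0 <= m < b l) (letter (i, k) - letter (l, m)) * Q = lvar i ^+ (b l) * upair i l
  /\ forall K, i \in K -> ge_deg K (((l \notin K) && (i < n0 <= l)%N)%:Z) Q.
Proof.
move=> il kb; rewrite /upair; have ai := a_gt0 i; have al := a_gt0 l.
case: ifPn => [lt_il|]; last rewrite -leqNgt leq_eqVlt => /orP[/eqP/val_inj e|lt_li].
- have [|||Q [QE Qdeg]] := @letters_quotient_deg F q q_inj n i l 0 (b i) (a l - chi n0 i) (b l) k.
  + by [].
  + by [].
  + by have := chi_le1 i; have := chi_le1 l; lia.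
  exists Q; split; first by rewrite QE /dpair qpoch_qprod qpoch_shift.
  move=> K iK; apply: ge_degW (Qdeg K iK); case: (l \in K) => /=; first by rewrite mul0r.
  by rewrite mul1r /chi; lia.
- by rewrite e eqxx in il.
have [|||Q [QE Qdeg]] := @letters_quotient_deg F q q_inj n i l 1 (a i - chi n0 l) (b l) (b l) k.
- by [].
- by have := chi_le1 i; have := chi_le1 l; lia.
- by lia.
exists Q; split; first by rewrite QE /dpair qpoch_qprod qpoch_shift [in RHS]mulrA mulrAC mulrA.
move=> K iK; apply: ge_degW (Qdeg K iK); rewrite subrr mulr0.
by case: (l \in K) => //=; lia.
Qed.

Lemma upair1 i l : b i = 0%N -> b l = 0%N -> upair i l = 1.
Proof.
rewrite /chi => bi bl; have ai := a_gt0 i; have al := a_gt0 l.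
rewrite /upair /dpair /chi.
have -> : (a i - (l < n0) = 0)%N by lia.
have -> : (a l - (i < n0) = 0)%N by lia.
have q0 (x : L) : qpoch q x 0 = 1 by exact: big_ord0.
by case: (i < l)%N; rewrite ?bi ?bl !q0 mulr1.
Qed.

Definition letter_index S : seq ('I_n * nat) :=
  [seq (i, k) | i <- enum S, k <- iota 0 (b i)].

Lemma mem_letter_index S i k : ((i, k) \in letter_index S) = (i \in S) && (k < b i)%N.
Proof.
apply/allpairsPdep/andP => [[l [m [+ + [-> ->]]]]|[iS kb]].
  by rewrite mem_enum mem_iota.
by exists i, k; rewrite mem_enum mem_iota.
Qed.

Lemma letter_index_uniq S : uniq (letter_index S).
Proof.
apply: allpairs_uniq_dep => [|i _|]; rewrite ?enum_uniq ?iota_uniq //.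
by move=> [i k] [l m] _ _ [-> ->].
Qed.

Lemma size_letter_index S : size (letter_index S) = (\sum_(i in S) b i)%N.
Proof.
rewrite size_allpairs_dep sumnE big_map big_enum.
by apply: eq_bigr => i _; rewrite size_iota.
Qed.

Lemma prod_letter_index S (P : pred ('I_n * nat)) (G : 'I_n * nat -> L) :
  \prod_(z <- letter_index S | P z) G z
  = \prod_(i in S) \prod_(0 <= k < b i | P (i, k)) G (i, k).
Proof.
rewrite big_mkcond big_allpairs_dep big_enum; apply: eq_bigr => i _.
by rewrite -big_mkcond /index_iota subn0.
Qed.

Lemma same_letters_prod i k : (k < b i)%N -> exists2 c : F, c != 0 &
  \prod_(0 <= m < b i | (i, m) != (i, k)) (letter (i, k) - letter (i, m))
  = c *: lvar i ^+ (b i).-1.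
Proof.
move=> kb; exists (\prod_(0 <= m < b i | m != k) (q ^+ k - q ^+ m)).
  rewrite prodf_seq_neq0; apply/allP => m _; apply/implyP => mk.
  by rewrite subr_eq0; apply: contraNneq mk => /q_inj->.
have -> : (b i).-1 = count (predC1 k) (index_iota 0 (b i)).
  have := count_predC (pred1 k) (index_iota 0 (b i)).
  rewrite count_uniq_mem ?iota_uniq // mem_index_iota kb size_iota subn0.
  by move/(congr1 predn) => /= <-.
have -> (x : L) p : x ^+ p = iter p ( *%R x) 1 by rewrite iter_mulr_1.
rewrite -big_const_seq -scaler_prod; apply: eq_big => m.
  by rewrite xpair_eqE eqxx.
by rewrite /letter /= scalerBl.
Qed.

Lemma lvarX i k : lvar i ^+ k = lmonom F (evar i *+ k).
Proof. by elim: k => // k IH; rewrite exprS IH mulrS lmonomD. Qed.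

Lemma prod_letter_diff S i k : i \in S -> (k < b i)%N -> exists2 c : F, c != 0 &
  \prod_(z <- letter_index S | z != (i, k)) (letter (i, k) - letter z)
  = c *: lvar i ^+ (b i).-1
    * \prod_(l in S :\ i) \prod_(0 <= m < b l) (letter (i, k) - letter (l, m)).
Proof.
move=> iS kb; have [c c0 cE] := same_letters_prod kb; exists c => //.
rewrite prod_letter_index (big_setD1 i iS) cE; congr (_ * _).
apply: eq_bigr => l; rewrite !inE => /andP[li _]; apply: eq_bigl => m.
by rewrite xpair_eqE (negPf li).
Qed.

Lemma letter_residue S i k : i \in S -> (k < b i)%N -> exists A : L,
  \prod_(z <- letter_index S | z != (i, k)) (letter (i, k) - letter z)
      * (lmonom F (- (evar i *+ (size (letter_index S)).-1)) * (A * dyson (S :\ i)))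
    = dyson S /\
  forall K, i \in K ->
    ge_deg K (\sum_(l in S :\ i) ((l \notin K) && (i < n0 <= l)%N)%:Z) A.
Proof.
move=> iS kb; have [c c0 cE] := prod_letter_diff iS kb.
have hex l : exists Ql : L, l != i ->
    \prod_(0 <= m < b l) (letter (i, k) - letter (l, m)) * Ql = lvar i ^+ (b l) * upair i l
    /\ forall K, i \in K -> ge_deg K (((l \notin K) && (i < n0 <= l)%N)%:Z) Ql.
  case: (eqVneq l i) => [->|li]; first by exists 0.
  by have [|Ql hl] := @upair_quotient i l k _ kb; [rewrite eq_sym|exists Ql].
have [Q hQ] := fin_all_exists hex.
exists (c^-1 *: \prod_(l in S :\ i) Q l); split; last first.
  move=> K iK; apply: supp_in_scale; apply: ge_deg_prod => l; rewrite !inE => /andP[li _].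
  by case: (hQ l li) => _; apply.
have QE : \prod_(l in S :\ i) \prod_(0 <= m < b l) (letter (i, k) - letter (l, m))
      * \prod_(l in S :\ i) Q l
    = lvar i ^+ (\sum_(l in S :\ i) b l) * \prod_(l in S :\ i) upair i l.
  rewrite -prodrXr -!big_split; apply: eq_bigr => l; rewrite !inE => /andP[li _].
  by case: (hQ l li).
have XE : lvar i ^+ (b i).-1 * lvar i ^+ (\sum_(l in S :\ i) b l)
    * lmonom F (- (evar i *+ (size (letter_index S)).-1)) = 1 :> L.
  rewrite -exprD lvarX -lmonomD size_letter_index (big_setD1 i iS) /=.
  have -> (s : nat) : ((b i).-1 + s = (b i + s).-1)%N by move: (b i) kb => p; lia.
  by rewrite subrr lmonom0.
rewrite cE (dyson_setD1 iS) /=.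
exact: residue_cancel c0 QE XE.
Qed.

Local Notation letters S := (map letter (letter_index S)).

(* If all alphabets of S are empty, then all pair factors in S are 1, and any
   variable of S may be peeled off for free. *)
Lemma hsym_dyson S r : S != set0 -> exists A : 'I_n -> L,
  hsym (letters S) r * dyson S = \sum_(i in S) A i * dyson (S :\ i) /\
  forall i K, i \in S -> i \in K ->
    ge_deg K (r%:Z + \sum_(l in S :\ i) ((l \notin K) && (i < n0 <= l)%N)%:Z) (A i).
Proof.
move=> S0; case: (eqVneq (letter_index S) [::]) => [s0|s0].
  have b0 l : l \in S -> b l = 0%N.
    move=> lS; apply/eqP; rewrite -leqn0 leqNgt; apply/negP => bl.
    by have := mem_letter_index S l 0; rewrite lS bl s0.
  have [i iS] := set0Pn _ S0.
  exists (fun l => if (l == i) && (r == 0)%N then 1 else 0); split.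
    rewrite s0 hsym_nil (bigD1 i) //= eqxx /= big1 => [|l /andP[_ /negPf->]]; last first.
      by rewrite mul0r.
    rewrite addr0; case: eqP => _; last by rewrite !mul0r.
    rewrite (dyson_setD1 iS) [X in X * dyson _]big1 ?mul1r // => l.
    by rewrite !inE => /andP[_ lS]; apply: upair1; apply: b0.
  move=> l K lS lK; case: (l == i); last by move=> u; rewrite msupp0.
  case: eqP => [->|_]; last by move=> u; rewrite msupp0.
  rewrite add0r big1 => [|j]; first exact: ge_deg1.
  rewrite !inE => /andP[_ jS]; have := b0 j jS; have aj := a_gt0 j; rewrite /chi.
  by case: (ltnP j n0) => jn0 bj; [rewrite !andbF|lia].
have hex z : z \in letter_index S -> exists Az : L,
    \prod_(y <- letter_index S | y != z) (letter z - letter y)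
      * (lmonom F (- (evar z.1 *+ (size (letter_index S)).-1)) * (Az * dyson (S :\ z.1)))
    = dyson S /\
    forall K, z.1 \in K ->
      ge_deg K (\sum_(l in S :\ z.1) ((l \notin K) && (z.1 < n0 <= l)%N)%:Z) Az.
  by case: z => i k; rewrite mem_letter_index => /andP[iS kb]; apply: letter_residue iS kb.
have [A hA] := seq_choice 0 hex.
pose w (z : 'I_n * nat) : L := lmonom F (- (evar z.1 *+ (size (letter_index S)).-1)).
pose N := (r + (size (letter_index S)).-1)%N.
exists (fun i => \sum_(0 <= k < b i) letter (i, k) ^+ N * w (i, k) * A (i, k)); split.
  rewrite (@hsym_lagrange _ _ letter _ (dyson S)
    (fun z => w z * (A z * dyson (S :\ z.1)))) ?letter_index_uniq //; last 2 first.
  - by move=> y z _ _; apply: letter_lreg.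
  - by move=> z /hA[].
  rewrite big_allpairs_dep big_enum; apply: eq_bigr => i _.
  rewrite mulr_suml /index_iota subn0; apply: eq_bigr => k _.
  by rewrite !mulrA.
move=> i K iS iK; rewrite big_seq; apply: supp_in_sum => k; rewrite mem_index_iota /= => kb.
apply: ge_degM; last first.
  by have [|_] := hA (i, k); [rewrite mem_letter_index iS|apply].
rewrite /letter exprZn lvarX -scalerAl -lmonomD; apply: supp_in_scale.
suff <- : wdeg K (evar i *+ N + - (evar i *+ (size (letter_index S)).-1)) = r%:Z.
  exact: ge_deg_mon.
by rewrite wdegD wdegN !wdegMn wdeg_evar iK /N !natz; lia.
Qed.

Lemma ge_deg_hsym K (d : int) (Y : seq L) r :
  (forall x, x \in Y -> ge_deg K d x) -> ge_deg K (d *+ r) (hsym Y r).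
Proof.
elim: Y r => [|x Y IH] r hY.
  rewrite hsym_nil; case: r => [|r]; first exact: ge_deg1.
  by move=> u; rewrite msupp0.
rewrite hsym_cons; apply: supp_in_sum => m _.
have -> : d *+ r = d *+ m + d *+ (r - m) by rewrite -mulrnDr subnKC // -ltnS.
apply: ge_degM; first by apply: ge_degX; apply: hY; rewrite mem_head.
by apply: IH => y yY; apply: hY; rewrite inE yY orbT.
Qed.

Lemma ge_deg_letter K i k : ge_deg K (i \in K)%:Z (letter (i, k)).
Proof. by rewrite -wdeg_evar; apply: supp_in_scale; apply: ge_deg_mon. Qed.

Lemma ge_deg_hsym_part K (mu : seq nat) : ge_deg K 0 (hsym_part (letters setT) mu).
Proof.
apply: ge_deg_prod0 => r _; rewrite -(mul0rn _ r).
apply: ge_deg_hsym => _ /mapP[[i k] _ ->].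
by apply: ge_degW (@ge_deg_letter K i k).
Qed.

Lemma letter_index_setC J :
  perm_eq (letter_index setT) (letter_index J ++ letter_index (~: J)).
Proof.
apply: uniq_perm; rewrite ?letter_index_uniq //.
  rewrite cat_uniq !letter_index_uniq andbT; apply/hasPn => -[i k].
  by rewrite !mem_letter_index inE => /andP[/negPf-> _].
by move=> [i k]; rewrite mem_cat !mem_letter_index !inE; case: (i \in J); rewrite //= orbF.
Qed.

Definition bonus J K : int :=
  \sum_(i in K :\: J) \sum_(l in ~: K) (i < n0 <= l)%N%:Z.

Lemma bonus_setU1 J K i : i \notin J -> i |: J \subset K ->
  bonus J K = \sum_(l in (~: J) :\ i) ((l \notin K) && (i < n0 <= l)%N)%:Z
              + bonus (i |: J) K.
Proof.
move=> iJ sub; rewrite /bonus (big_setD1 i); last first.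
  by rewrite inE iJ (subsetP sub) // setU11.
congr (_ + _); last first.
  by apply: eq_bigl => l; rewrite !inE negb_or andbA.
rewrite [RHS](eq_bigr (fun l => if l \notin K then (i < n0 <= l)%N%:Z else 0)); last first.
  by move=> l _; case: ifP.
rewrite -big_mkcondr; apply: eq_bigl => l; rewrite !inE.
case: (boolP (l \in K)) => lK; rewrite ?andbF // andbT.
apply/esym/andP; split; apply: contra lK.
  by move/eqP->; rewrite (subsetP sub) // setU11.
by move=> lJ; rewrite (subsetP sub) // setU1r.
Qed.

Lemma hsym_part_dyson J (mu : seq nat) : (#|J| + size mu <= n)%N ->
  supp_in (fun u => exists K, [/\ J \subset K, #|K| = (#|J| + size mu)%N &
             (sumn mu)%:Z + bonus J K <= wdeg K u])
    (hsym_part (letters setT) mu * dyson (~: J)).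
Proof.
elim: mu J => [|r mu IH] J; rewrite /= ?addn0 => Jn.
  move=> u; rewrite /hsym_part big_nil mul1r => hu; exists J; split=> //.
  rewrite /bonus setDv big_set0 addr0.
  have : ge_deg J 0 (dyson (~: J)).
    apply: ge_deg_prod0 => i; rewrite inE => iJ.
    apply: ge_deg_prod0 => j; rewrite inE => /andP[jJ _].
    rewrite -[0]addr0; apply: ge_degM; apply: ge_deg_prod0 => s _; rewrite ?scalerA.
      by apply: ge_deg_lin; rewrite // wdegD wdegN !wdeg_evar (negPf iJ) (negPf jJ).
    by apply: ge_deg_lin; rewrite // wdegD wdegN !wdeg_evar (negPf iJ) (negPf jJ).
  by apply.
have S0 : ~: J != set0.
  rewrite -card_gt0 cardsCs setCK card_ord subn_gt0.
  by apply: leq_trans Jn; rewrite addnS ltnS leq_addr.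
have [A hA] := fin_all_exists (fun m : 'I_r.+1 => hsym_dyson (r - m) S0).
have -> : hsym_part (letters setT) (r :: mu) * dyson (~: J)
    = \sum_(m < r.+1) \sum_(i in ~: J) (hsym (letters J) m * A m i)
         * (hsym_part (letters setT) mu * dyson (~: J :\ i)).
  rewrite /hsym_part big_cons -/(hsym_part _ mu).
  rewrite (hsym_perm _ (perm_map letter (letter_index_setC J))) map_cat hsym_cat.
  rewrite -mulrA mulr_suml; apply: eq_bigr => m _; case: (hA m) => e _.
  by rewrite mulrACA e mulr_sumr; apply: eq_bigr => i _; rewrite mulrACA.
apply: supp_in_sum => m _; apply: supp_in_sum => i; rewrite inE => iJ u /msuppM.
have -> : ~: J :\ i = ~: (i |: J) by rewrite setCU setIC -setDE.
move=> [u1 [u2 [h1 h2 ->]]].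
have [|K [sub cK degK]] := IH (i |: J) _ u2 h2; first by rewrite cardsU1 iJ add1n addSnnS.
exists K; split; first exact: subset_trans (subsetUr _ _) sub.
  by rewrite cK cardsU1 iJ add1n addSnnS.
have iK : i \in K by rewrite (subsetP sub) // setU11.
have hJ : ge_deg K m%:Z (hsym (letters J) m).
  rewrite -[m%:Z]natz; apply: ge_deg_hsym => _ /mapP[[l k] + ->].
  rewrite mem_letter_index => /andP[lJ _].
  by have := @ge_deg_letter K l k; rewrite (subsetP sub) // setU1r.
have iJ' : i \in ~: J by rewrite inE.
have := ge_degM hJ ((hA m).2 i K iJ' iK) h1.
rewrite (bonus_setU1 iJ sub) wdegD PoszD.
have mr : (m <= r)%N by rewrite -ltnS.
move: degK; rewrite -subzn // => d2 d1; apply: le_trans (lerD d1 d2).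
by rewrite le_eqVlt; apply/orP; left; apply/eqP; ring.
Qed.

Lemma bonus0 K : (n0 <= n)%N -> let p := #|[set i in K | (i < n0)%N]| in
  bonus set0 K = p%:Z * (n%:Z - n0%:Z - #|K|%:Z + p%:Z).
Proof.
move=> n0n p; rewrite /bonus setD0.
have cardE (A : {set 'I_n}) (P : pred 'I_n) :
    \sum_(i in A) (P i)%:Z = #|[set i in A | P i]|%:Z.
  by rewrite -sum1_card -natz natr_sum [RHS]big_set big_mkcondr; apply: eq_bigr => i _; case: (P i).
pose Z := [set i : 'I_n | (i < n0)%N].
have cZ : #|Z| = n0.
  by rewrite -sum1dep_card (big_ord_narrow n0n) sum1_card card_ord.
pose c := #|[set l in ~: K | (n0 <= l)%N]|.
have pE : p = #|K :&: Z| by apply: eq_card => i; rewrite !inE.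
have cE : c = #|~: Z :\: K| by apply: eq_card => i; rewrite !inE -leqNgt.
have ZK : ~: Z :&: K = K :\: Z by rewrite setIC -setDE.
have -> : n%:Z - n0%:Z - #|K|%:Z + p%:Z = c%:Z.
  have := cardsID Z K; have := cardsID K (~: Z); have := cardsC Z.
  rewrite cZ ZK -pE -cE card_ord.
  by move: c p {pE cE} #|K| #|K :\: Z| #|~: Z| => c p k d e; lia.
rewrite /p -(cardE K (fun i : 'I_n => (i < n0)%N)) mulr_suml; apply: eq_bigr => i _.
case: (i < n0)%N; last by rewrite mul0r big1.
by rewrite mul1r cardE.
Qed.

End Dyson.

Lemma qvar_inj : injective (fun k => qvar ^+ k).
Proof.
move=> k m; rewrite /qvar -!rmorphXn => /eqP.
rewrite tofrac_eq => /eqP/(congr1 (fun p : {poly rat} => size p)).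
by rewrite !size_polyXn => -[].
Qed.

Lemma alphabet_letters n n0 (a : 'I_n -> nat) :
  alphabet n0 a = map (@letter _ qvar n) (letter_index n0 a setT).
Proof. by rewrite /alphabet /letter_index map_allpairs enum_setT enumT. Qed.

Lemma qDyson_dyson n n0 (a : 'I_n -> nat) :
  qDyson n0 a = dyson qvar n0 a setT.
Proof.
rewrite /qDyson /dyson; apply: eq_big => [i|i _]; first by rewrite inE.
by apply: eq_bigl => j; rewrite inE.
Qed.

Theorem theorem1p1 (n n0 : nat) (a : 'I_n -> nat) (v : {ffun 'I_n -> int})
    (lam : seq nat)
    (hn : (0 < n)%N) (hn0 : (n0 <= n)%N) (ha : forall i, (0 < a i)%N)
    (hlam : is_partition lam) (hsize : (sumn lam)%:Z = \sum_(i < n) v i)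
    (hj : exists j : nat, [/\ (0 < j)%N, (j < n)%N
       & forall I : {set 'I_n}, #|I| = j ->
           let pI := #|[set i in I | (i < n0)%N]| in
           \sum_(i in I) v i
             - pI%:Z * (n%:Z - n0%:Z - j%:Z + pI%:Z)
           < (\sum_(k < j) nth 0%N lam k)%:Z]) :
  Dct n0 a v lam = 0.
Proof.
case: hj => j [j0 jn hI].
pose mu := [seq nth 0%N lam k | k <- index_iota 0 j].
have szmu : size mu = j by rewrite size_map size_iota subn0.
have summu : sumn mu = (\sum_(k < j) nth 0%N lam k)%N.
  by rewrite sumnE big_map big_mkord.
have lamE (R : comNzRingType) (X : seq R) :
    hsym_part X lam = hsym_part X mu * hsym_part X (drop j lam).
  rewrite (hsym_part_split X lam j) [hsym_part X mu]big_map.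
  by rewrite big_mkord.
rewrite /Dct alphabet_letters qDyson_dyson lamE.
pose X := map (@letter _ qvar n) (letter_index n0 a setT).
rewrite (_ : lmonom _ _ * _ * _ = lmonom Qq (- v) * hsym_part X (drop j lam)
    * (hsym_part X mu * dyson qvar n0 a setT)); last first.
  by rewrite -!mulrA; congr (_ * _); rewrite mulrCA.
apply/eqP; rewrite /CT mcoeff_eq0; apply/negP.
have hmu : (#|@set0 'I_n| + size mu <= n)%N by rewrite cards0 szmu ltnW.
have := hsym_part_dyson qvar_inj ha hmu; rewrite setC0 => hsupp.
move=> /msuppM[u1 [u2 [h1 /hsupp[K [_ cK degK]] e0]]].
rewrite cards0 szmu add0n in cK.
have := ge_degM (@ge_deg_mon Qq n K (- v))
  (@ge_deg_hsym_part Qq qvar n n0 a K (drop j lam)) h1.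
have /= := hI K cK; rewrite -[\sum_(i in K) v i]/(wdeg K v).
move: degK (congr1 (wdeg K) e0); rewrite bonus0 // cK summu !wdegD wdegN /=.
rewrite wdeg0.
by move: (_ * _) (\sum_(k < j) _)%N%:Z (wdeg K v) (wdeg K u1) (wdeg K u2); lia.
Qed.
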